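(* Let $G$ be an abelian group, $R$ a $G$-graded commutative ring, $M$ a $G$-graded $R$-module, $s\in h^*(R)$, and $P$ a graded ideal of $R$ with $s\notin P$. Then the following are equivalent: (1) $P\in GSpec_s(R)$. (2) $P(+)M\in GSpec_{(s,m)}(R(+)M)$ for every $m\in h(M)$. (3) $P(+)M\in GSpec_{(s,0)}(R(+)M)$.
   Context: Rings are commutative with nonzero unity $1$ and modules are unital. A ring $R$ is $G$-graded if $R=\bigoplus_{g\in G}R_g$ with additive subgroups $R_g$ satisfying $R_gR_h\subseteq R_{gh}$; $h(R)=\bigcup_{g\in G}R_g$ and $h^*(R)=h(R)\setminus\{0\}$. An $R$-module $M$ is $G$-graded if $M=\bigoplus_{g\in G}M_g$ with additive subgroups $M_g$ satisfying $R_gM_h\subseteq M_{gh}$; $h(M)=\bigcup_{g\in G}M_g$. An ideal $I$ of $R$ is graded if $I=\bigoplus_{g\in G}(I\cap R_g)$. The idealization $R(+)M=\{(r,m):r\in R, m\in M\}$ is the commutative ring with componentwise addition and multiplication $(x,m_1)(y,m_2)=(xy,xm_2+ym_1)$; for $G$ abelian it is $G$-graded by $(R(+)M)_g=R_g(+)M_g=\{(r,m):r\in R_g,m\in M_g\}$. For an ideal $P$ of $R$, $P(+)M=\{(p,m):p\in P,m\in M\}$, which is a graded ideal of $R(+)M$ when $P$ is graded. For a graded ring $A$ and a nonzero $u\in A$, $GSpec_u(A)$ denotes the set of graded $u$-prime ideals of $A$: graded ideals $I$ of $A$ with $u\notin I$ such that for all $a,b\in h(A)$, $ab\in I$ implies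 $ua\in I$ or $ub\in I$ (in (2) this condition is used with $u=(s,m)$ even when $(s,m)$ is not homogeneous). *)

(* Defs.v *)
From HB Require Import structures.
From mathcomp Require Import all_boot all_algebra.
From mathcomp Require Import classical_sets.

Set Implicit Arguments.
Unset Strict Implicit.
Unset Printing Implicit Defensive.

Import GRing.Theory.
Local Open Scope classical_set_scope.
Local Open Scope ring_scope.

Section DirectSum.
Variables (I : eqType) (V : zmodType).
Implicit Types (A : I -> set V) (C : set V).

Definition additive_subgroup (H : set V) : Prop :=
  H 0 /\ forall x y, H x -> H y -> H (x - y).

(* C is the internal direct sum of the subgroups A i: C consists of the finite
   sums of elements of the A i, and the only such sum equal to 0 is the trivial
   one. A finite sum is indexed by a duplicate-free sequence r of indices; the
   values of f outside r are irrelevant. *)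
Definition internal_direct_sum C A : Prop :=
  [/\ forall i, additive_subgroup (A i),
      forall x, C x <->
        exists (r : seq I) (f : I -> V),
          [/\ uniq r, forall i, A i (f i) & x = \sum_(i <- r) f i]
    & forall (r : seq I) (f : I -> V),
        uniq r -> (forall i, A i (f i)) -> \sum_(i <- r) f i = 0 ->
        forall i, i \in r -> f i = 0].

Definition homogeneous A : set V := \bigcup_i A i.

End DirectSum.

Section Graded.
Variable G : groupType.

Definition graded_ring (R : comNzRingType) (Rg : G -> set R) : Prop :=
  internal_direct_sum setT Rg /\
  forall g h x y, Rg g x -> Rg h y -> Rg (g * h)%g (x * y).

Definition graded_module (R : comNzRingType) (Rg : G -> set R)
    (M : lmodType R) (Mg : G -> set M) : Prop :=
  internal_direct_sum setT Mg /\
  forall g h x m, Rg g x -> Mg h m -> Mg (g * h)%g (x *: m).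

Definition ideal (R : comNzRingType) (J : set R) : Prop :=
  additive_subgroup J /\ forall a x, J x -> J (a * x).

Definition graded_ideal (R : comNzRingType) (Rg : G -> set R) (J : set R) :
    Prop :=
  ideal J /\ internal_direct_sum J (fun g => J `&` Rg g).

(* u is not required to be homogeneous; u != 0 follows from ~ J u. *)
Definition GSpec (R : comNzRingType) (Rg : G -> set R) (u : R) : set (set R) :=
  [set J | [/\ graded_ideal Rg J, ~ J u
             & forall a b, homogeneous Rg a -> homogeneous Rg b ->
                 J (a * b) -> J (u * a) \/ J (u * b)]].

End Graded.

(* The alias keeps the multiplication below apart from the componentwise one
   that MathComp puts on a product of rings. *)
Definition idealization (R : comNzRingType) (M : lmodType R) : Type :=
  (R * M)%type.

Section Idealization.
Variables (R : comNzRingType) (M : lmodType R).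

HB.instance Definition _ := GRing.Zmodule.copy (idealization M) (R * M)%type.

Definition idealization_one : idealization M := (1, 0).

Definition idealization_mul (a b : idealization M) : idealization M :=
  (a.1 * b.1, a.1 *: b.2 + b.1 *: a.2).

Fact idealization_mulA : associative idealization_mul.
Proof.
move=> [x a] [y b] [z c]; rewrite /idealization_mul /=; congr (_, _).
  exact: mulrA.
by rewrite !scalerDr !scalerA -!addrA [z * x]mulrC [z * y]mulrC.
Qed.

Fact idealization_mulC : commutative idealization_mul.
Proof.
move=> [x a] [y b]; rewrite /idealization_mul /=; congr (_, _).
  exact: mulrC.
exact: addrC.
Qed.

Fact idealization_mul1 : left_id idealization_one idealization_mul.
Proof.
by move=> [x a]; rewrite /idealization_mul /= mul1r scale1r scaler0 addr0.
Qed.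

Fact idealization_mulDl : left_distributive idealization_mul +%R.
Proof.
move=> [x a] [y b] [z c]; rewrite /idealization_mul /=; congr (_, _).
  exact: mulrDl.
by rewrite scalerDl scalerDr addrACA.
Qed.

Fact idealization_one_neq0 : idealization_one != 0.
Proof. by apply/eqP => -[/eqP]; rewrite oner_eq0. Qed.

HB.instance Definition _ := GRing.Zmodule_isComNzRing.Build (idealization M)
  idealization_mulA idealization_mulC idealization_mul1 idealization_mulDl
  idealization_one_neq0.

Definition idealization_grading (G : groupType)
    (Rg : G -> set R) (Mg : G -> set M) : G -> set (idealization M) :=
  fun g => Rg g `*` Mg g.

Definition idealization_ideal (P : set R) : set (idealization M) :=
  P `*` setT.

End Idealization.

Arguments idealization_ideal {R} M P.

(* Main.v *)
Require Import Defs.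
From mathcomp Require Import all_boot all_algebra.
From mathcomp Require Import classical_sets.

Local Open Scope classical_set_scope.
Local Open Scope ring_scope.

Import GRing.Theory.

(* The homogeneous components of R(+)M are the products R_g x M_g, so P(+)M is
   graded because a product of direct sums is a direct sum. Membership of
   (x, m) in P(+)M only depends on x, so the primality conditions for P and for
   P(+)M differ only in the elements quantified over; the components M_g are
   never empty since they contain 0. *)

Lemma additive_subgroupX (V W : zmodType) (H : set V) (K : set W) :
  additive_subgroup H -> additive_subgroup K ->
  @additive_subgroup (V * W)%type (H `*` K).
Proof.
move=> [H0 HB] [K0 KB]; split=> // x y [Hx Kx] [Hy Ky].
by split; [exact: HB | exact: KB].
Qed.

(** Extending [f] by 0 outside [r] keeps its values in the subgroups and leaves the sum unchanged.
    This lets decompositions over different index sequences be rewritten over a common one. *)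
Lemma sum_widen (I : eqType) (V : zmodType) (A : I -> set V)
    (r r' : seq I) (f : I -> V) :
    (forall i, additive_subgroup (A i)) ->
    uniq r -> uniq r' -> {subset r <= r'} -> (forall i, A i (f i)) ->
  exists2 f' : I -> V, forall i, A i (f' i) &
    \sum_(i <- r) f i = \sum_(i <- r') f' i.
Proof.
move=> subA ur ur' rr' Af; exists (fun i => if i \in r then f i else 0).
  by move=> i; case: ifP => // _; by case: (subA i).
(* The terms of [r'] that survive are those lying in [r]; both sequences being duplicate-free, they
   form a permutation of [r]. *)
rewrite -big_mkcond -[RHS]big_filter; apply: perm_big.
apply: uniq_perm => [//||i]; first exact: filter_uniq.
by rewrite mem_filter andbC; case: (boolP (i \in r)) => [/rr' ->|]; rewrite ?andbF.
Qed.

Lemma sum_pair (I : Type) (V W : zmodType) (r : seq I) (f : I -> V * W) :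
  \sum_(i <- r) f i = (\sum_(i <- r) (f i).1, \sum_(i <- r) (f i).2).
Proof.
elim: r => [|i r IHr]; first by rewrite !big_nil.
by rewrite !big_cons IHr; case: (f i).
Qed.

Lemma internal_direct_sumX (I : eqType) (V W : zmodType)
    (C : set V) (A : I -> set V) (D : set W) (B : I -> set W) :
  internal_direct_sum C A -> internal_direct_sum D B ->
  @internal_direct_sum I (V * W)%type (C `*` D) (fun i => A i `*` B i).
Proof.
move=> [subA spanA freeA] [subB spanB freeB]; split.
- by move=> i; exact: additive_subgroupX.
- move=> [x y]; split.
    move=> [/= /spanA[r [f [ur Af ->]]] /spanB[r' [f' [ur' Bf' ->]]]].
    (* The two coordinates decompose over unrelated sequences [r] and [r']; both sums are moved to
       their duplicate-free union [t] and then paired termwise. *)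
    have ut := undup_uniq (r ++ r'); set t := undup _ in ut.
    have [|g Ag ->] := sum_widen _ _ _ r t f subA ur ut _ Af.
      by move=> i ri; rewrite mem_undup mem_cat ri.
    have [|g' Bg' ->] := sum_widen _ _ _ r' t f' subB ur' ut _ Bf'.
      by move=> i ri; rewrite mem_undup mem_cat ri orbT.
    exists t, (fun i => (g i, g' i)); split=> //.
    by rewrite sum_pair.
  move=> [r [f [ur ABf]]]; rewrite sum_pair => -[-> ->]; split=> /=.
    by apply/spanA; exists r, (fun i => (f i).1); split=> // i; case: (ABf i).
  by apply/spanB; exists r, (fun i => (f i).2); split=> // i; case: (ABf i).
- move=> r f ur ABf; rewrite sum_pair => -[f10 f20] i ri.
  rewrite [f i]surjective_pairing.
  rewrite (freeA r (fun i => (f i).1) ur _ f10 i ri); last first.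
    by move=> j; case: (ABf j).
  rewrite (freeB r (fun i => (f i).2) ur _ f20 i ri) //.
  by move=> j; case: (ABf j).
Qed.

Lemma idealization_ideal_graded (G : groupType) (R : comNzRingType)
    (Rg : G -> set R) (M : lmodType R) (Mg : G -> set M) (P : set R) :
  graded_module Rg Mg -> graded_ideal Rg P ->
  graded_ideal (idealization_grading Rg Mg) (idealization_ideal M P).
Proof.
move=> [Mdsum _] [[subP mulP] Pdsum]; split.
  split; first exact: (additive_subgroupX R M).
  by move=> a x [Px _]; split=> //; exact: mulP.
(* Each component of [P(+)M] is again a product, so the decompositions of [P] and of [M] combine
   into one of [P(+)M]. *)
have -> : (fun g => idealization_ideal M P `&` idealization_grading Rg Mg g)
    = (fun g => (P `&` Rg g) `*` Mg g).
  apply: boolp.funext => g; apply/seteqP; split=> -[x m] /=.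
    by move=> [[Px _] [Rx Mm]].
  by move=> [[Px Rx] Mm].
exact: internal_direct_sumX.
Qed.

Theorem proposition3p16 (G : groupType)
    (G_abelian : forall g h : G, (g * h = h * g)%g)
    (R : comNzRingType) (Rg : G -> set R) (R_graded : graded_ring Rg)
    (M : lmodType R) (Mg : G -> set M) (M_graded : graded_module Rg Mg)
    (s : R) (s_hom : homogeneous Rg s) (s_neq0 : s != 0)
    (P : set R) (P_graded : graded_ideal Rg P) (sNP : ~ P s) :
  let RMg := idealization_grading Rg Mg in
  let PM := idealization_ideal M P in
  let stmt1 := GSpec Rg s P in
  let stmt2 := forall m : M, homogeneous Mg m -> GSpec RMg (s, m) PM in
  let stmt3 := GSpec RMg (s, 0) PM in
  (stmt1 <-> stmt2) /\ (stmt2 <-> stmt3).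
Proof.
move=> RMg PM stmt1 stmt2 stmt3.
have Mg0 g : Mg g 0 by case: M_graded => -[/(_ g)[]].
have imp12 : stmt1 -> stmt2.
  move=> [_ _ primeP] m _; split; first exact: idealization_ideal_graded.
    by case.
  move=> [a n] [b n'] [g _ [/= Ra _]] [h _ [/= Rb _]] [/= Pab _].
  (* Only first coordinates matter: [(s, m) * (a, n)] has first coordinate [s * a], whatever [m] and
     [n] are. *)
  by have [||//|Psa|Psb] := primeP a b; [exists g|exists h|left|right].
(* Zero is homogeneous of every degree; the degree 1 is an arbitrary choice. *)
have imp23 : stmt2 -> stmt3 by apply; exists 1%g.
have imp31 : stmt3 -> stmt1.
  move=> [_ _ primePM]; split=> // a b [g _ Ra] [h _ Rb] Pab.
  (* With second coordinate 0, [a] and [b] lift to homogeneous elements of the same degrees. *)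
  have [||//|[Psa _]|[Psb _]] := primePM (a, 0) (b, 0); first by exists g.
  - by exists h.
  - by left.
  - by right.
by split; split; auto.
Qed.
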